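(* Let $R$ be a basic formal matrix ring of order $n$ with local corners $R_1,\dots,R_n$ and with a Nakayama permutation $\pi$, and let $i\le n$. If the right and left socles of $R$ coincide, then there exists a skew field $K$ such that for every $j$ in the cycle of $\pi$ containing $i$, the residue skew field $R_j/J(R_j)$ is isomorphic to $K$.
   Context: Rings are associative and unital; $J(R)$ is the Jacobson radical. Formal matrix ring of order $n$: given local rings $R_1,\dots,R_n$ (local corners), $R_i$-$R_j$-bimodules $B_{i,j}$ with $B_{i,i}=R_i$, and $R_i$-$R_k$-bimodule homomorphisms $\varphi_{i,j,k}\colon B_{i,j}\otimes_{R_j}B_{j,k}\to B_{i,k}$, written $ab:=\varphi_{i,j,k}(a\otimes b)$, where $\varphi_{i,i,j}$ and $\varphi_{i,j,j}$ are the bimodule actions and $(ab)c=a(bc)$ for all $a\in B_{i,j}$, $b\in B_{j,k}$, $c\in B_{k,l}$. The ring $R$ is the set of $n\times n$ matrices whose $(i,j)$ entry lies in $B_{i,j}$, with the usual matrix addition and multiplication. The canonical idempotent $e_i$ is the matrix with $1_{R_i}$ at position $(i,i)$ and zeros elsewhere. $R$ is basic if the right modules $e_1R,\dots,e_nR$ are pairwise non-isomorphic. Nakayama permutation: a basic formal matrix ring $R$ of order $n$ is a ring with a Nakayama permutation $\pi\in S_n$ if for each $i\le n$ one has $soc(e_iR)\cong top(e_{\pi(i)}R)$ as right $R$-modules and $soc(Re_{\pi(i)})\cong top(Re_i)$ as left $R$-modules, where $top(M)=M/MJ(R)$ (resp. $M/J(R)M$). *)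

(* Defs.v *)
(* MathComp; the classical layer `boolp` turns propositions into booleans, so
   that every subset of a module is a `{pred M}`. *)
From HB Require Import structures.
From mathcomp Require Import all_boot all_fingroup all_algebra.
From mathcomp Require Import generic_quotient ring_quotient.
From mathcomp Require Import boolp.

Set Implicit Arguments.
Unset Strict Implicit.
Unset Printing Implicit Defensive.

Import GRing.Theory.
Local Open Scope ring_scope.
Local Open Scope quotient_scope.

(* Right `R`-modules are rendered as `lmodType R^c`. *)

Section SubmoduleType.
Variables (R : pzRingType) (M : lmodType R).

Record submodule : Type :=
  Submodule { submod_pred :> {pred M}; submodP : submod_closed submod_pred }.

HB.instance Definition _ (N : submodule) :=
  GRing.isSubmodClosed.Build R M (submod_pred N) (submodP N).

Record submod_type (N : submodule) : Type :=
  SubmodElt { submod_val : M; submod_valP : submod_val \in N }.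

HB.instance Definition _ N := [isSub for @submod_val N].
HB.instance Definition _ N := [Choice of submod_type N by <:].
HB.instance Definition _ (N : submodule) :=
  GRing.SubChoice_isSubLmodule.Build R M (submod_pred N) (submod_type N)
    (submodP N).

End SubmoduleType.

Section QuotientModule.
Variables (R : pzRingType) (M : lmodType R) (N : submodule M).

Local Notation Q := {ideal_quot (submod_pred N)}.

Definition quot_mod : Type := Q.
HB.instance Definition _ := GRing.Zmodule.on quot_mod.

Definition quot_scale (a : R) (x : quot_mod) : quot_mod :=
  \pi_Q (a *: repr (x : Q)).

Lemma quot_scale_pi a (u : M) :
  quot_scale a (\pi_Q u) = \pi_Q (a *: u).
Proof.
apply/eqmodP; rewrite /= /Quotient.equiv -scalerBr.
by apply: rpredZ; rewrite Quotient.idealrBE reprK.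
Qed.

Fact quot_scaleA a b x : quot_scale a (quot_scale b x) = quot_scale (a * b) x.
Proof.
by rewrite -[x](@reprK _ Q) !quot_scale_pi scalerA.
Qed.

Fact quot_scale1 : left_id 1 quot_scale.
Proof.
by move=> x; rewrite -[x](@reprK _ Q) quot_scale_pi scale1r.
Qed.

Fact quot_scaleDr : right_distributive quot_scale +%R.
Proof.
move=> a x y; rewrite -[x](@reprK _ Q) -[y](@reprK _ Q).
have piD u v : (\pi_Q u : quot_mod) + \pi_Q v = \pi_Q (u + v).
  by rewrite [RHS](raddfD (\pi_Q)).
by rewrite piD !quot_scale_pi scalerDr piD.
Qed.

Fact quot_scaleDl x : {morph quot_scale^~ x : a b / a + b}.
Proof.
move=> a b; rewrite -[x](@reprK _ Q) !quot_scale_pi scalerDl.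
by rewrite [LHS](raddfD (\pi_Q)).
Qed.

HB.instance Definition _ := GRing.Zmodule_isLmodule.Build R quot_mod
  quot_scaleA quot_scale1 quot_scaleDr quot_scaleDl.

End QuotientModule.

Section ModuleTheory.
Variables (R : pzRingType) (M : lmodType R).

Definition span_pred (P : M -> Prop) : {pred M} :=
  [pred x | `[< forall N : submodule M,
                  (forall y, P y -> y \in N) -> x \in N >]].

Fact span_pred_closed P : submod_closed (span_pred P).
Proof.
split=> [|a u v /asboolP uP /asboolP vP]; apply/asboolP => N PN.
  exact: rpred0.
by apply: rpredD; [apply/rpredZ/uP | apply: vP].
Qed.

Definition span (P : M -> Prop) : submodule M := Submodule (span_pred_closed P).

Definition cyclic_pred (m : M) : {pred M} :=
  [pred x | `[< exists a : R, x = a *: m >]].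

Fact cyclic_pred_closed m : submod_closed (cyclic_pred m).
Proof.
split=> [|a _ _ /asboolP[b ->] /asboolP[c ->]]; apply/asboolP.
  by exists 0; rewrite scale0r.
by exists (a * b + c); rewrite scalerDl scalerA.
Qed.

Definition cyclic_submod (m : M) : submodule M :=
  Submodule (cyclic_pred_closed m).

Definition simple_submod (S : submodule M) : Prop :=
  (exists2 x, x \in S & x != 0) /\
  (forall N : submodule M, {subset N <= S} ->
     (forall x, x \in N -> x = 0) \/ {subset S <= N}).

Definition maximal_submod (S : submodule M) : Prop :=
  (exists x, x \notin S) /\
  (forall N : submodule M, {subset S <= N} ->
     {subset N <= S} \/ (forall x, x \in N)).

(* The sum of all the simple submodules. *)
Definition socle : submodule M :=
  span (fun x => exists2 S : submodule M, simple_submod S & x \in S).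

(* `IM`: finite sums of products `a *: m` with `a` in `I`. *)
Definition smul_submod (I : {pred R}) : submodule M :=
  span (fun x => exists2 a, a \in I & exists m, x = a *: m).

End ModuleTheory.

Definition lmod_iso (R : pzRingType) (M N : lmodType R) : Prop :=
  exists f : {linear M -> N}, bijective f.

Definition left_regular (R : pzRingType) : lmodType R := R^o.

(* Here `a *: x` is `x * a`, computed in `R`. *)
Definition right_regular (R : pzRingType) : lmodType R^c := (R^c)^o.

Section Jacobson.
Variable R : pzRingType.

(* The intersection of the maximal right ideals. *)
Definition jacobson : {pred R} :=
  [pred x | `[< forall m : submodule (right_regular R),
                  maximal_submod m -> x \in m >]].

Fact jacobson_zmod_closed : zmod_closed jacobson.
Proof.
split=> [|x y /asboolP xJ /asboolP yJ]; apply/asboolP => m mM.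
  exact: (rpred0 m).
exact: (rpredB (xJ m mM) (yJ m mM)).
Qed.

HB.instance Definition _ :=
  GRing.isZmodClosed.Build R jacobson jacobson_zmod_closed.

Lemma jacobsonMr x a : x \in jacobson -> x * a \in jacobson.
Proof.
move=> /asboolP xJ; apply/asboolP => m mM.
exact: (rpredZ (a : R^c) (xJ m mM)).
Qed.

Section Preimage.
Variables (m : submodule (right_regular R)) (a : R).

Definition preim_pred : {pred right_regular R} := [pred r | (a * r : R) \in m].

Fact preim_pred_closed : submod_closed preim_pred.
Proof.
split=> [|b u v]; rewrite !inE ?mulr0; first exact: (rpred0 m).
move=> um vm; rewrite mulrDr; apply: (@rpredD _ m); last exact: vm.
by rewrite [X in X \in _](_ : _ = (b : R^c) *: (a * u : right_regular R));
  [exact: rpredZ | rewrite /GRing.scale/= mulrA].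
Qed.

Definition add_pred (y : R) : {pred right_regular R} :=
  [pred r | `[< exists2 u : R, u \in m & exists s : R, r = u + y * s >]].

Fact add_pred_closed y : submod_closed (add_pred y).
Proof.
split=> [|b _ _ /asboolP[u um [s ->]] /asboolP[v vm [t ->]]]; apply/asboolP.
  by exists 0; [exact: (rpred0 m) | exists 0; rewrite mulr0 addr0].
exists ((b : R^c) *: (u : right_regular R) + v).
  by apply: (@rpredD _ m) => //; exact: rpredZ.
exists (s * b + t).
suff: (u + y * s) * b + (v + y * t) = u * b + v + y * (s * b + t) by [].
by rewrite mulrDr mulrDl addrACA mulrA.
Qed.

Lemma preim_maximal x :
  maximal_submod m -> a * x \notin m ->
  maximal_submod (Submodule preim_pred_closed).
Proof.
move=> [_ mM] axm; split; first by exists x.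
move=> N sN.
have [[y yN yP]|NN] := pselect (exists2 y, y \in N & y \notin preim_pred);
  last first.
  by left=> y yN; apply: contrapT => /negP yP; apply: NN; exists y.
right=> r; set m' := Submodule (add_pred_closed (a * y)).
have m_m' : {subset m <= m'}.
  by move=> u um; apply/asboolP; exists u => //; exists 0; rewrite mulr0 addr0.
have [N'|N'] := mM m' m_m'.
  case/negP: yP; apply: (N' (a * y : R)); apply/asboolP.
  by exists 0; [exact: (rpred0 m) | exists 1; rewrite mulr1 add0r].
have /asboolP[u um [s ars]] := N' (a * r : R).
rewrite -[r](@subrK R ((y : R) * s)); apply: (@rpredD _ N).
  have eq_u : a * ((r : R) - (y : R) * s) = u.
    by rewrite (@mulrBr R) (@mulrA R) ars (@addrK R).
  by apply: sN; rewrite inE; move: um; rewrite -eq_u.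
exact: (rpredZ (s : R^c) yN).
Qed.

End Preimage.

Lemma jacobsonMl a x : x \in jacobson -> a * x \in jacobson.
Proof.
move=> /asboolP xJ; apply/asboolP => m mM.
apply: contrapT => /negP axm; case/negP: (axm).
exact: (xJ _ (preim_maximal mM axm)).
Qed.

Local Notation Q := {ideal_quot jacobson}.

Definition residue_ring : Type := Q.
HB.instance Definition _ := GRing.Zmodule.on residue_ring.

Definition residue_one : residue_ring := \pi_Q 1.
Definition residue_mul (x y : residue_ring) : residue_ring :=
  \pi_Q (repr (x : Q) * repr (y : Q)).

Lemma residue_mul_pi (a b : R) :
  residue_mul (\pi_Q a) (\pi_Q b) =
  \pi_Q (a * b).
Proof.
apply/eqmodP; rewrite /= /Quotient.equiv.
set a' := repr _; set b' := repr _.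
have aJ : a' - a \in jacobson by rewrite Quotient.idealrBE reprK.
have bJ : b' - b \in jacobson by rewrite Quotient.idealrBE reprK.
rewrite -[a' * b'](subrK (a' * b)) -addrA -mulrBr -mulrBl.
by apply: rpredD; [exact: jacobsonMl | exact: jacobsonMr].
Qed.

Lemma residue_piD (a b : R) :
  (\pi_Q a : residue_ring) + \pi_Q b =
  \pi_Q (a + b).
Proof. by rewrite [RHS](raddfD (\pi_Q)). Qed.

Fact residue_mulA : associative residue_mul.
Proof.
move=> x y z; rewrite -[x](@reprK _ Q).
rewrite -[y](@reprK _ Q) -[z](@reprK _ Q).
by rewrite !residue_mul_pi mulrA.
Qed.

Fact residue_mul1 : left_id residue_one residue_mul.
Proof.
by move=> x; rewrite -[x](@reprK _ Q) residue_mul_pi mul1r.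
Qed.

Fact residue_mulr1 : right_id residue_one residue_mul.
Proof.
by move=> x; rewrite -[x](@reprK _ Q) residue_mul_pi mulr1.
Qed.

Fact residue_mulDl : left_distributive residue_mul +%R.
Proof.
move=> x y z; rewrite -[x](@reprK _ Q).
rewrite -[y](@reprK _ Q) -[z](@reprK _ Q).
by rewrite residue_piD !residue_mul_pi residue_piD mulrDl.
Qed.

Fact residue_mulDr : right_distributive residue_mul +%R.
Proof.
move=> x y z; rewrite -[x](@reprK _ Q).
rewrite -[y](@reprK _ Q) -[z](@reprK _ Q).
by rewrite residue_piD !residue_mul_pi residue_piD mulrDr.
Qed.

HB.instance Definition _ := GRing.Zmodule_isPzRing.Build residue_ring
  residue_mulA residue_mul1 residue_mulr1 residue_mulDl residue_mulDr.

End Jacobson.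

Arguments jacobson R : clear implicits.

Definition skew_field (K : pzRingType) : Prop :=
  (1 : K) != 0 /\ forall x : K, x != 0 -> exists y : K, x * y = 1 /\ y * x = 1.

Definition local_ring (R : pzRingType) : Prop := skew_field (residue_ring R).

Definition ring_iso (R S : pzRingType) : Prop :=
  exists f : {rmorphism R -> S}, bijective f.

Definition right_top (R : pzRingType) (M : lmodType R^c) : lmodType R^c :=
  quot_mod (smul_submod M (jacobson R : {pred R^c})).

Definition left_top (R : pzRingType) (M : lmodType R) : lmodType R :=
  quot_mod (smul_submod M (jacobson R)).

Definition right_socle (R : pzRingType) : {pred R} := socle (right_regular R).
Definition left_socle (R : pzRingType) : {pred R} := socle (left_regular R).

Arguments right_socle R : clear implicits.
Arguments left_socle R : clear implicits.

(* The data defining a formal matrix ring of order `n`, without the locality of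
   the corners.  The corner `R_i` is `fm_entry i i` with the multiplication
   `fm_mul i i i`.  The products are given as biadditive maps: the axioms with
   `i = j`, `j = k` or `k = l` are those of the rings `R_i`, of the
   `R_i`-`R_j`-bimodules `B_{i,j}` (whose actions are `fm_mul i i j` and
   `fm_mul i j j`), and state that `fm_mul i j k` is `R_j`-balanced and
   `R_i`-`R_k`-linear, i.e. that it is a bimodule homomorphism out of the tensor
   product over `R_j`. *)
Record fm_data (n : nat) := FmData {
  fm_entry : 'I_n -> 'I_n -> zmodType;
  fm_one : forall i, fm_entry i i;
  fm_mul : forall i j k, fm_entry i j -> fm_entry j k -> fm_entry i k;
  fm_mulDl : forall i j k (a b : fm_entry i j) (c : fm_entry j k),
    fm_mul (a + b) c = fm_mul a c + fm_mul b c;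
  fm_mulDr : forall i j k (a : fm_entry i j) (b c : fm_entry j k),
    fm_mul a (b + c) = fm_mul a b + fm_mul a c;
  fm_mul1l : forall i j (a : fm_entry i j), fm_mul (fm_one i) a = a;
  fm_mul1r : forall i j (a : fm_entry i j), fm_mul a (fm_one j) = a;
  fm_mulA : forall i j k l
      (a : fm_entry i j) (b : fm_entry j k) (c : fm_entry k l),
    fm_mul (fm_mul a b) c = fm_mul a (fm_mul b c)
}.

Section FormalMatrixRing.
Variables (n : nat) (F : fm_data n).

Definition corner (i : 'I_n) : Type := fm_entry F i i.

HB.instance Definition _ i := GRing.Zmodule.on (corner i).

Definition corner_mul i (a b : corner i) : corner i := fm_mul a b.

Fact corner_mulA i : associative (@corner_mul i).
Proof. by move=> a b c; rewrite /corner_mul fm_mulA. Qed.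
Fact corner_mul1 i : left_id (fm_one F i : corner i) (@corner_mul i).
Proof. by move=> a; exact: fm_mul1l. Qed.
Fact corner_mulr1 i : right_id (fm_one F i : corner i) (@corner_mul i).
Proof. by move=> a; exact: fm_mul1r. Qed.
Fact corner_mulDl i : left_distributive (@corner_mul i) +%R.
Proof. by move=> a b c; exact: fm_mulDl. Qed.
Fact corner_mulDr i : right_distributive (@corner_mul i) +%R.
Proof. by move=> a b c; exact: fm_mulDr. Qed.

HB.instance Definition _ i := GRing.Zmodule_isPzRing.Build (corner i)
  (@corner_mulA i) (@corner_mul1 i) (@corner_mulr1 i)
  (@corner_mulDl i) (@corner_mulDr i).

Definition fmatrix : Type := forall i j : 'I_n, fm_entry F i j.

HB.instance Definition _ := gen_eqMixin fmatrix.
HB.instance Definition _ := gen_choiceMixin fmatrix.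

Lemma fmatrixP (A B : fmatrix) : (forall i j, A i j = B i j) -> A = B.
Proof. by move=> AB; do 2!apply: functional_extensionality_dep => ?. Qed.

Definition fmatrix_zero : fmatrix := fun i j => 0.
Definition fmatrix_opp (A : fmatrix) : fmatrix := fun i j => - A i j.
Definition fmatrix_add (A B : fmatrix) : fmatrix := fun i j => A i j + B i j.

Fact fmatrix_addA : associative fmatrix_add.
Proof. by move=> A B C; apply: fmatrixP => i j; exact: addrA. Qed.
Fact fmatrix_addC : commutative fmatrix_add.
Proof. by move=> A B; apply: fmatrixP => i j; exact: addrC. Qed.
Fact fmatrix_add0 : left_id fmatrix_zero fmatrix_add.
Proof. by move=> A; apply: fmatrixP => i j; exact: add0r. Qed.
Fact fmatrix_addN : left_inverse fmatrix_zero fmatrix_opp fmatrix_add.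
Proof. by move=> A; apply: fmatrixP => i j; exact: addNr. Qed.

HB.instance Definition _ := GRing.isZmodule.Build fmatrix
  fmatrix_addA fmatrix_addC fmatrix_add0 fmatrix_addN.

(* The Kronecker symbol: `fm_one i` if `i = j`, and 0 otherwise. *)
Definition fm_delta (i j : 'I_n) : fm_entry F i j :=
  match i =P j with
  | ReflectT eq_ij => eq_rect i (fm_entry F i) (fm_one F i) j eq_ij
  | ReflectF _ => 0
  end.

Lemma fm_deltaii i : fm_delta i i = fm_one F i.
Proof. by rewrite /fm_delta; case: eqP => // eq_ii; rewrite eq_axiomK. Qed.

Lemma fm_delta_neq i j : i != j -> fm_delta i j = 0.
Proof. by rewrite /fm_delta; case: eqP. Qed.

Definition fmatrix_one : fmatrix := fm_delta.
Definition fmatrix_mul (A B : fmatrix) : fmatrix :=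
  fun i k => \sum_(j < n) fm_mul (A i j) (B j k).

Lemma fm_mul0l i j k (b : fm_entry F j k) : fm_mul (0 : fm_entry F i j) b = 0.
Proof. by apply: (addrI (fm_mul 0 b)); rewrite -fm_mulDl !addr0. Qed.

Lemma fm_mul0r i j k (a : fm_entry F i j) : fm_mul a (0 : fm_entry F j k) = 0.
Proof. by apply: (addrI (fm_mul a 0)); rewrite -fm_mulDr !addr0. Qed.

Lemma fm_mul_suml i j k (f : 'I_n -> fm_entry F i j) (b : fm_entry F j k) :
  fm_mul (\sum_h f h) b = \sum_h fm_mul (f h) b.
Proof.
apply: (big_morph (fun a => fm_mul a b)) => [x y|].
  exact: fm_mulDl.
exact: fm_mul0l.
Qed.

Lemma fm_mul_sumr i j k (a : fm_entry F i j) (f : 'I_n -> fm_entry F j k) :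
  fm_mul a (\sum_h f h) = \sum_h fm_mul a (f h).
Proof.
by apply: (big_morph (fm_mul a)) => [x y|]; [exact: fm_mulDr | exact: fm_mul0r].
Qed.

Fact fmatrix_mulA : associative fmatrix_mul.
Proof.
move=> A B C; apply: fmatrixP => i l; rewrite /fmatrix_mul.
under eq_bigr do rewrite fm_mul_sumr.
under [RHS]eq_bigr do rewrite fm_mul_suml.
rewrite exchange_big; do 2!apply: eq_bigr => ? _.
by rewrite fm_mulA.
Qed.
Fact fmatrix_mul1 : left_id fmatrix_one fmatrix_mul.
Proof.
move=> A; apply: fmatrixP => i j; rewrite /fmatrix_mul (bigD1 i) //=.
rewrite [fmatrix_one i i]fm_deltaii fm_mul1l big1 ?addr0 // => k ki.
by rewrite [fmatrix_one i k]fm_delta_neq 1?eq_sym // fm_mul0l.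
Qed.
Fact fmatrix_mulr1 : right_id fmatrix_one fmatrix_mul.
Proof.
move=> A; apply: fmatrixP => i j; rewrite /fmatrix_mul (bigD1 j) //=.
rewrite [fmatrix_one j j]fm_deltaii fm_mul1r big1 ?addr0 // => k kj.
by rewrite [fmatrix_one k j]fm_delta_neq // fm_mul0r.
Qed.
Fact fmatrix_mulDl : left_distributive fmatrix_mul +%R.
Proof.
move=> A B C; apply: fmatrixP => i j; rewrite /fmatrix_mul.
by rewrite -[RHS]big_split; apply: eq_bigr => k _; exact: fm_mulDl.
Qed.
Fact fmatrix_mulDr : right_distributive fmatrix_mul +%R.
Proof.
move=> A B C; apply: fmatrixP => i j; rewrite /fmatrix_mul.
by rewrite -[RHS]big_split; apply: eq_bigr => k _; exact: fm_mulDr.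
Qed.

HB.instance Definition _ := GRing.Zmodule_isPzRing.Build fmatrix
  fmatrix_mulA fmatrix_mul1 fmatrix_mulr1 fmatrix_mulDl fmatrix_mulDr.

Definition fm_idem (i : 'I_n) : fmatrix :=
  fun j k => if j == i then fm_delta j k else 0.

Definition eR (i : 'I_n) : lmodType fmatrix^c :=
  submod_type (cyclic_submod (fm_idem i : right_regular fmatrix)).

Definition Re (i : 'I_n) : lmodType fmatrix :=
  submod_type (cyclic_submod (fm_idem i : left_regular fmatrix)).

Definition local_corners : Prop := forall i, local_ring (corner i).

Definition basic : Prop := forall i j, i != j -> ~ lmod_iso (eR i) (eR j).

Definition nakayama_perm (pi : 'S_n) : Prop :=
  forall i,
    lmod_iso (submod_type (socle (eR i)) : lmodType fmatrix^c)
             (right_top (eR (pi i))) /\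
    lmod_iso (submod_type (socle (Re (pi i))) : lmodType fmatrix)
             (left_top (Re i)).

End FormalMatrixRing.

(* Main.v *)
Require Import Defs.
From HB Require Import structures.
From mathcomp Require Import all_boot all_fingroup all_algebra.
From mathcomp Require Import generic_quotient ring_quotient.
From mathcomp Require Import boolp.

Set Implicit Arguments.
Unset Strict Implicit.
Unset Printing Implicit Defensive.

Import GRing.Theory.
Local Open Scope ring_scope.
Local Open Scope quotient_scope.

(** The socle [S] of [R] cuts out in each entry [B_ij], [j = p i], a subgroup
    [T = {x | x E_ij in S}], stable under [R_i] on the left and [R_j] on the
    right.  The Nakayama condition makes [T] cyclic on both sides: [soc (e_i R)]
    is isomorphic to [top (e_j R)], which is generated by the class of [e_j] and
    killed by [J(R)].  Transporting the generator gives a nonzero [t] in [T]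
    with [T = t R_j] and [T J(R_j) = 0] ([right_socle_generator]).  Since [S] is also
    the left socle, the condition on [soc (R e_j)] gives symmetrically [t'] with
    [T = R_i t'] and [J(R_i) T = 0] ([left_socle_generator]).  Writing
    [t = r t'], the element [r] is invertible modulo [J(R_i)] because [t] is
    nonzero, so that [T = R_i t = t R_j].

    Every [a] in [R_i] is therefore matched by some [b] in [R_j] with
    [a t = t b], and conversely.  The annihilators of [t] on the two sides are
    [J(R_i)] and [J(R_j)], so this correspondence is an isomorphism
    [R_i/J(R_i) = R_j/J(R_j)] ([residue_iso_of_intertwiner]); iterating it along
    the cycle of [p] proves the theorem.

    The Jacobson radical of [R] enters in two ways: the radical of a corner lies
    in [J(R)] ([single_jacobson]), hence kills both tops, and [e_j] is not in
    [J(R)] ([idem_notin_jacobson]), hence the tops do not vanish.  Both are read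
    off the definition by maximal right ideals, moving such ideals between
    [R_j] and [R]. *)

(** * Socles and linear maps *)

Section LinearImage.
Variables (A : pzRingType) (M N : lmodType A) (f : M -> N).
Hypothesis f_lin : linear f.

Let f0 : f 0 = 0.
Proof.
have := f_lin 1 0 0.
by rewrite !scale1r addr0 -{1}[f 0]addr0 => /addrI.
Qed.

Definition preimage_pred (P : submodule N) : {pred M} := [pred x | f x \in P].

Fact preimage_closed P : submod_closed (preimage_pred P).
Proof.
split=> [|a u v]; rewrite !inE ?f0 ?f_lin; first exact: rpred0.
by move=> uP vP; apply: rpredD; first exact: rpredZ.
Qed.

Definition image_pred (S : submodule M) : {pred N} :=
  [pred y | `[< exists2 x, x \in S & y = f x >]].

Fact image_closed S : submod_closed (image_pred S).
Proof.
split=> [|a _ _ /asboolP[x xS ->] /asboolP[y yS ->]]; apply/asboolP.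
  by exists 0; rewrite ?f0 //; exact: rpred0.
by exists (a *: x + y); rewrite ?f_lin //; apply: rpredD; first exact: rpredZ.
Qed.

Definition inter_pred (S S' : submodule M) : {pred M} :=
  [pred x | (x \in S) && (x \in S')].

Fact inter_closed S S' : submod_closed (inter_pred S S').
Proof.
split=> [|a u v /andP[uS uS'] /andP[vS vS']]; apply/andP.
  by split; exact: rpred0.
by split; apply: rpredD => //; exact: rpredZ.
Qed.

(** A linear map sends a simple submodule to zero or to a simple submodule. *)
Lemma socle_linear x : x \in socle M -> f x \in socle N.
Proof.
move=> /asboolP xsoc.
apply: (xsoc (Submodule (preimage_closed (socle N)))) => y [S [_ Smin] yS].
rewrite inE; have [->|fy_neq0] := eqVneq (f y) 0; first exact: rpred0.
apply/asboolP => P; apply; exists (Submodule (image_closed S)); last first.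
  by apply/asboolP; exists y.
split=> [|Q QS]; first by exists (f y) => //; apply/asboolP; exists y.
(* A submodule of the image is controlled by its preimage in [S]. *)
set S' := Submodule (inter_closed S (Submodule (preimage_closed Q))).
have S_S' : {subset S' <= S} by move=> z /andP[].
have [S'0|SS'] := Smin S' S_S'.
  left=> z zQ; have /asboolP[s sS zE] := QS z zQ; rewrite zE.
  by rewrite (S'0 s) //; apply/andP; split; rewrite // inE -zE.
by right=> _ /asboolP[s /SS' /andP[_ sQ] ->].
Qed.

End LinearImage.

(** * Generators of socles isomorphic to tops *)

(* Left modules over an arbitrary ring [A] cover both sides: the right-hand case
   is that of the converse ring. *)
Section SocleTop.
Variables (A : pzRingType) (I : {pred A}) (e e' : A).
Hypotheses (eK : e * e = e) (e'K : e' * e' = e').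
Hypothesis I_zmod : zmod_closed I.
Hypothesis I_mull : forall a x, x \in I -> a * x \in I.
Hypothesis I_mulr : forall a x, x \in I -> x * a \in I.

Local Notation cyclic_mod x :=
  (submod_type (cyclic_submod (x : left_regular A)) : lmodType A).

Fact mulr_cyclic (x a : A) : (a * x : A) \in cyclic_submod (x : left_regular A).
Proof. by apply/asboolP; exists a. Qed.

Definition to_cyclic (x : A) (a : left_regular A) : cyclic_mod x :=
  SubmodElt (mulr_cyclic x a).

Lemma to_cyclic_linear x : linear (to_cyclic x).
Proof.
move=> a u v; apply: val_inj; rewrite [LHS](@mulrDl A).
by congr (_ + _); rewrite [RHS](@mulrA A).
Qed.

Lemma submod_val_linear (x : A) :
  linear (fun u : cyclic_mod x => (submod_val u : left_regular A)).
Proof. by []. Qed.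

Fact ideal_part_closed (x : A) :
  submod_closed ([pred u : submod_type (cyclic_submod (x : left_regular A)) |
                   (submod_val u : A) \in I] : {pred cyclic_mod x}).
Proof.
have [I0 IB] := I_zmod; split=> [|a u v]; rewrite !inE; first exact: I0.
move=> uI vI.
rewrite [X in X \in I](_ : _ = a * submod_val u - - submod_val v);
  last by rewrite opprK.
by apply: (IB); [exact: I_mull | rewrite -[- _]add0r; apply: IB].
Qed.

(** The idempotent [e'] generates [A e' / I A e'] and is fixed by [e'], and [I]
    kills its class; the element [t] is the image of this class in [soc (A e)].
    That every [x = x e] in [soc A] lies in [soc (A e)] uses the projection of
    [A] onto its direct summand [A e]. *)
Lemma socle_top_generator :
  lmod_iso (submod_type (socle (cyclic_mod e)))
           (quot_mod (smul_submod (cyclic_mod e') I)) ->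
  exists t : A, [/\ t \in socle (left_regular A), e' * t = t /\ t * e = t,
    forall x : A, x \in socle (left_regular A) -> x * e = x ->
      exists r, x = r * t,
    forall k, k \in I -> k * t = 0 & t = 0 -> e' \in I].
Proof.
case=> f [g fK gK].
pose W := smul_submod (cyclic_mod e') I.
pose c (x : A) : submod_type (cyclic_submod (e' : left_regular A)) :=
  to_cyclic e' x.
pose gen : quot_mod W := \pi_{ideal_quot (submod_pred W)} (c 1).
have genZ a : a *: gen = \pi_{ideal_quot (submod_pred W)} (c a).
  rewrite [LHS]quot_scale_pi; congr (\pi _); apply: val_inj.
  by rewrite /= mul1r.
have gZ a x : g (a *: x) = a *: g x.
  by apply: (can_inj fK); rewrite gK linearZ /= gK.
pose U := g gen; pose t : A := submod_val (submod_val U).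
have tZ a : a *: U = g (\pi_{ideal_quot (submod_pred W)} (c a)).
  by rewrite -genZ gZ.
have te : t * e = t.
  have /asboolP[a tE] := submod_valP (submod_val U).
  by rewrite /t tE; rewrite -[LHS](@mulrA A) eK.
exists t; split.
- exact: (socle_linear (@submod_val_linear e) (submod_valP U)).
- split=> //.
  suff -> : t = submod_val (submod_val (e' *: U)).
    by rewrite [LHS](@mulrA A) e'K.
  rewrite tZ; congr (submod_val (submod_val (g (\pi _)))); apply: val_inj.
  by rewrite /= e'K mul1r.
- move=> x xsoc xe.
  pose X : submod_type (socle (cyclic_mod e)) :=
    SubmodElt (socle_linear (@to_cyclic_linear e) xsoc).
  have xE : x = submod_val (submod_val X) by rewrite /= xe.
  pose y := repr (f X : {ideal_quot (submod_pred W)}).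
  have /asboolP[r yE] := submod_valP y.
  exists r; rewrite xE.
  suff -> : X = r *: U by [].
  rewrite tZ -[X]fK -[f X]reprK; congr (g (\pi _)); exact: val_inj.
- move=> k kI.
  suff /(congr1 (fun z => submod_val (submod_val z))) : k *: U = 0 by [].
  rewrite -gZ genZ.
  have -> : \pi_{ideal_quot (submod_pred W)} (c k) = 0
      :> quot_mod W.
    apply/eqP; rewrite -[0](raddf0 (\pi_{ideal_quot (submod_pred W)})).
    rewrite eqmodE /= /Quotient.equiv subr0.
    apply/asboolP => P; apply; exists k => //; exists (c 1).
    by apply: val_inj; rewrite /= mul1r.
  by rewrite -[0 : quot_mod W](scale0r gen) gZ scale0r.
- move=> t0.
  have U0 : U = 0 by do 2!apply: val_inj.
  have : gen = 0.
    by rewrite -[gen]gK -/U U0 raddf0.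
  rewrite -[0](raddf0 (\pi_{ideal_quot (submod_pred W)})) => /eqP.
  rewrite eqmodE /= /Quotient.equiv subr0 => /asboolP gW.
  have := gW (Submodule (@ideal_part_closed e')); rewrite inE /= mul1r.
  by apply=> _ [a aI [m ->]]; exact: I_mulr.
Qed.
End SocleTop.

(** * Residue rings of local rings *)

Section LocalRing.
Variable R : pzRingType.

Definition residue (a : R) : residue_ring R := \pi_{ideal_quot (jacobson R)} a.

Lemma residue_eq (a b : R) : (residue a == residue b) = (a - b \in jacobson R).
Proof. exact: eqmodE. Qed.

Lemma residueB (a b : R) : residue (a - b) = residue a - residue b.
Proof. exact: (raddfB (\pi_{ideal_quot (jacobson R)})). Qed.

Lemma residueM (a b : R) : residue (a * b) = residue a * residue b.
Proof. by rewrite [RHS]residue_mul_pi. Qed.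

Lemma residue_repr (x : residue_ring R) : exists a, x = residue a.
Proof.
by exists (repr (x : {ideal_quot (jacobson R)})); rewrite /residue reprK.
Qed.

Lemma residue_eq0 (a : R) : (residue a == 0) = (a \in jacobson R).
Proof.
rewrite -[0](raddf0 (\pi_{ideal_quot (jacobson R)})).
by have := residue_eq a 0; rewrite subr0.
Qed.

Hypothesis R_local : local_ring R.

Lemma one_notin_jacobson : 1 \notin jacobson R.
Proof. by rewrite -residue_eq0; case: R_local. Qed.

Lemma notin_jacobson_unit (a : R) : a \notin jacobson R ->
  exists2 b, a * b - 1 \in jacobson R & b * a - 1 \in jacobson R.
Proof.
rewrite -residue_eq0 => /(proj2 R_local) [y].
have [b ->] := residue_repr y => -[ab ba].
by exists b; rewrite -residue_eq residueM ?ab ?ba.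
Qed.

End LocalRing.

Lemma ring_iso_refl (R : pzRingType) : ring_iso R R.
Proof. by exists idfun; exists idfun. Qed.

Lemma ring_iso_trans (R S T : pzRingType) :
  ring_iso R S -> ring_iso S T -> ring_iso R T.
Proof. by case=> f f_bij [g g_bij]; exists (g \o f); exact: bij_comp. Qed.

(** Stated for a correspondence because the isomorphism sought is only given by
    an equation [a t = t b] between representatives of residue classes, in
    which the two rings play the same role. *)
Lemma ring_iso_of_rel (R S : pzRingType) (r : R -> S -> Prop) :
  (forall x, exists y, r x y) -> (forall y, exists x, r x y) ->
  (forall x x' y y', r x y -> r x' y' -> (x = x' <-> y = y')) ->
  r 1 1 -> (forall x x' y y', r x y -> r x' y' -> r (x - x') (y - y')) ->
  (forall x x' y y', r x y -> r x' y' -> r (x * x') (y * y')) ->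
  ring_iso R S.
Proof.
move=> tot surj inj r1 rB rM.
have [f rf] := choice tot; have [g rg] := choice surj.
have fE x y : r x y -> f x = y by move=> rxy; apply/(inj _ _ _ _ (rf x) rxy).
have f_zmod : zmod_morphism f by move=> x y; apply/fE/rB.
have f_monoid : monoid_morphism f by split=> [|x y]; apply/fE => //; exact: rM.
pose fA := GRing.isZmodMorphism.Build R S f f_zmod.
pose fM := GRing.isMonoidMorphism.Build R S f f_monoid.
pose fR : {rmorphism R -> S} := HB.pack f fA fM.
exists fR; exists g => [x|y]; last exact: fE.
by apply/(inj _ _ _ _ (rg (f x)) (rf x)).
Qed.

Lemma ring_iso_sym (R S : pzRingType) : ring_iso R S -> ring_iso S R.
Proof.
case=> f f_bij; apply: (@ring_iso_of_rel _ _ (fun y x => y = f x)).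
- by case: f_bij => g fK gK y; exists (g y).
- by move=> x; exists (f x).
- by move=> _ _ x x' -> ->; split=> [/(bij_inj f_bij)|->].
- by rewrite rmorph1.
- by move=> _ _ x x' -> ->; rewrite rmorphB.
- by move=> _ _ x x' -> ->; rewrite rmorphM.
Qed.

(** * Single-entry matrices *)

Section Matrices.
Variables (n : nat) (F : fm_data n).
Local Notation R := (fmatrix F).

Lemma corner_mulE i (a b : corner F i) : a * b = fm_mul a b.
Proof. by []. Qed.

Lemma fm_mulBl k l m (x y : fm_entry F k l) (z : fm_entry F l m) :
  fm_mul (x - y) z = fm_mul x z - fm_mul y z.
Proof. by apply: (addIr (fm_mul y z)); rewrite -fm_mulDl !subrK. Qed.

Lemma fm_mulBr k l m (x : fm_entry F k l) (y z : fm_entry F l m) :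
  fm_mul x (y - z) = fm_mul x y - fm_mul x z.
Proof. by apply: (addIr (fm_mul x z)); rewrite -fm_mulDr !subrK. Qed.

(** The two Kronecker symbols put [x] at position [(i, j)] without transporting
    it between the types of the entries. *)
Definition fm_single i j (x : fm_entry F i j) : R :=
  fun k l => fm_mul (fm_mul (fm_delta F k i) x) (fm_delta F j l).

Lemma fm_singleE i j (x : fm_entry F i j) : fm_single x i j = x.
Proof. by rewrite /fm_single !fm_deltaii fm_mul1l fm_mul1r. Qed.

Lemma fmE (A B : R) i j : (A * B) i j = \sum_k fm_mul (A i k) (B k j).
Proof. by []. Qed.

Lemma mul_delta i j (A : forall k, fm_entry F k j) :
  \sum_k fm_mul (fm_delta F i k) (A k) = A i.
Proof.
rewrite (bigD1 i) //= fm_deltaii fm_mul1l big1 ?addr0 // => k ki.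
by rewrite fm_delta_neq 1?eq_sym // fm_mul0l.
Qed.

Lemma delta_mul i j (A : forall k, fm_entry F i k) :
  \sum_k fm_mul (A k) (fm_delta F k j) = A j.
Proof.
rewrite (bigD1 j) //= fm_deltaii fm_mul1r big1 ?addr0 // => k kj.
by rewrite fm_delta_neq // fm_mul0r.
Qed.

Lemma single_mull i j (x : fm_entry F i j) (A : R) k l :
  (fm_single x * A) k l = fm_mul (fm_mul (fm_delta F k i) x) (A j l).
Proof.
rewrite fmE; under eq_bigr do rewrite /fm_single fm_mulA.
by rewrite -fm_mul_sumr mul_delta.
Qed.

Lemma single_mulr i j (x : fm_entry F i j) (A : R) k l :
  (A * fm_single x) k l = fm_mul (A k i) (fm_mul x (fm_delta F j l)).
Proof.
rewrite fmE; under eq_bigr do rewrite /fm_single fm_mulA -fm_mulA.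
by rewrite -fm_mul_suml delta_mul.
Qed.

Lemma single_mul i j k (x : fm_entry F i j) (y : fm_entry F j k) :
  fm_single x * fm_single y = fm_single (fm_mul x y).
Proof.
apply: fmatrixP => p q.
by rewrite single_mull /fm_single fm_deltaii fm_mul1l !fm_mulA.
Qed.

Lemma idemE i : fm_idem F i = fm_single (fm_one F i).
Proof.
apply: fmatrixP => k l; rewrite /fm_idem /fm_single fm_mul1r.
case: eqP => [->|/eqP ki]; first by rewrite fm_deltaii fm_mul1l.
by rewrite (fm_delta_neq F ki) fm_mul0l.
Qed.

Lemma idemK i : fm_idem F i * fm_idem F i = fm_idem F i.
Proof. by rewrite idemE single_mul fm_mul1l. Qed.

Lemma idem_single i j (x : fm_entry F i j) :
  fm_idem F i * fm_single x = fm_single x.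
Proof. by rewrite idemE single_mul fm_mul1l. Qed.

Lemma single_idem i j (x : fm_entry F i j) :
  fm_single x * fm_idem F j = fm_single x.
Proof. by rewrite idemE single_mul fm_mul1r. Qed.

Lemma idem_corner i j (A : R) :
  fm_idem F i * A * fm_idem F j = fm_single (A i j).
Proof.
apply: fmatrixP => k l; rewrite !idemE single_mulr single_mull.
by rewrite fm_mul1r fm_mul1l.
Qed.

Lemma fm_singleB i j (x y : fm_entry F i j) :
  fm_single (x - y) = fm_single x - fm_single y.
Proof. by apply: fmatrixP => k l; rewrite /fm_single fm_mulBr fm_mulBl. Qed.

Lemma fm_singleD i j (x y : fm_entry F i j) :
  fm_single (x + y) = fm_single x + fm_single y.
Proof. by apply: fmatrixP => k l; rewrite /fm_single fm_mulDr fm_mulDl. Qed.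

Lemma fm_single0 i j : fm_single (0 : fm_entry F i j) = 0.
Proof. by apply: fmatrixP => k l; rewrite /fm_single fm_mul0r fm_mul0l. Qed.

(** * The Jacobson radical of a formal matrix ring *)

Fact single_preim_closed j (m : submodule (right_regular R)) :
  submod_closed ([pred r | fm_single (r : corner F j) \in m]
                   : {pred right_regular (corner F j)}).
Proof.
split=> [|a u v]; rewrite !inE; first by rewrite fm_single0; exact: rpred0.
move=> um vm; rewrite fm_singleD; apply: rpredD => //.
have -> : fm_single ((a : (corner F j)^c) *: u : right_regular (corner F j)) =
    fm_single (u : corner F j) * fm_single (a : corner F j).
  by rewrite single_mul.
exact: (rpredZ (fm_single (a : corner F j) : R^c) um).
Qed.

(** A maximal right ideal [m] of [R] contains [e_j] or meets the corner [R_j] in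
    a maximal right ideal; in both cases it contains [J(R_j)]. *)
Lemma single_jacobson j (k : corner F j) :
  k \in jacobson (corner F j) -> fm_single k \in jacobson R.
Proof.
move=> /asboolP kJ; apply/asboolP => m [_ m_max].
pose m' := Submodule (single_preim_closed j m).
have [em|em] := boolP (fm_idem F j \in m).
  by rewrite -idem_single; exact: (rpredZ (fm_single k : R^c) em).
suff m'_max : maximal_submod m' by have := kJ m' m'_max.
split=> [|N m'N]; first by exists (1 : corner F j); rewrite inE -idemE.
have [[r rN rm']|Nm'] := pselect (exists2 r, r \in N & r \notin m'); last first.
  by left=> r rN; apply: contrapT => /negP rm'; apply: Nm'; exists r.
right=> x; suff N1 : (1 : corner F j) \in N.
  by rewrite -[x](@mul1r (corner F j)); exact: (rpredZ (x : (corner F j)^c) N1).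
(* By maximality of [m], [e_j = u + r s] with [u] in [m]; multiplying by [e_j]
   on the right brings this equation into the corner. *)
pose mr := Submodule (add_pred_closed m (fm_single (r : corner F j))).
have m_mr : {subset m <= mr}.
  by move=> u um; apply/asboolP; exists u => //; exists 0; rewrite mulr0 addr0.
have [mrm|mrT] := m_max mr m_mr.
  case/negP: rm'; apply: mrm; apply/asboolP; exists 0; first exact: rpred0.
  by exists 1; rewrite mulr1 add0r.
have /asboolP[u um [s eE]] := mrT (fm_idem F j).
have uE : u = fm_idem F j - fm_single (r : corner F j) * s by rewrite eE addrK.
rewrite -[1](@subrK (corner F j) ((r : corner F j) * s j j)).
apply: rpredD; last exact: (rpredZ (s j j : (corner F j)^c) rN).
apply: m'N; rewrite inE fm_singleB.
have -> : fm_single ((r : corner F j) * s j j : corner F j) =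
    fm_single (r : corner F j) * s * fm_idem F j.
  rewrite -[in RHS]idem_single -[in RHS](mulrA (fm_idem F j)) idem_corner.
  by rewrite single_mull fm_deltaii fm_mul1l.
rewrite -idemE -[X in X - _]idemK -mulrBl -uE.
exact: (rpredZ (fm_idem F j : R^c) um).
Qed.

Section LocalCorner.
Variable j : 'I_n.
Hypothesis j_local : local_ring (corner F j).

(** The largest right ideal of [R] whose [(j, j)] entries lie in [J(R_j)]. *)
Definition row_pred : {pred right_regular R} :=
  [pred A | `[< forall l (y : fm_entry F l j),
      (fm_mul ((A : R) j l) y : corner F j) \in jacobson (corner F j) >]].

Fact row_pred_closed : submod_closed row_pred.
Proof.
split=> [|a u v /asboolP uJ /asboolP vJ]; apply/asboolP => l y.
  by rewrite fm_mul0l; exact: rpred0.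
have -> : fm_mul ((((a : R^c) *: u + v) : R) j l) y =
    \sum_k fm_mul ((u : R) j k) (fm_mul ((a : R) k l) y)
      + fm_mul ((v : R) j l) y.
  rewrite [LHS]fm_mulDl; congr (_ + _); rewrite fm_mul_suml.
  by apply: eq_bigr => k _; rewrite fm_mulA.
by apply: rpredD => //; apply: rpred_sum => k _; exact: uJ.
Qed.

(** The right ideal [row_pred] is maximal and does not contain [e_j]. *)
Lemma idem_notin_jacobson : fm_idem F j \notin jacobson R.
Proof.
have eN : (fm_idem F j : right_regular R) \notin row_pred.
  apply/negP => /asboolP /(_ j (fm_one F j)); rewrite idemE fm_singleE fm_mul1l.
  exact/negP/one_notin_jacobson.
apply/negP => /asboolP /(_ (Submodule row_pred_closed)) eJ.
case/negP: eN; apply: eJ; split.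
  exists (1 : R); apply/negP => /asboolP /(_ j (fm_one F j)).
  rewrite [X in fm_mul X](_ : _ = fm_one F j) ?fm_mul1l; last exact: fm_deltaii.
  exact/negP/one_notin_jacobson.
move=> N rN.
have [[A AN Ar]|NA] := pselect (exists2 A, A \in N & A \notin row_pred);
  last first.
  by left=> A AN; apply: contrapT => /negP Ar; apply: NA; exists A.
right=> B; suff N1 : (1 : R) \in N.
  by rewrite -[B](@mul1r R); exact: (rpredZ (B : R^c) N1).
have [l [y AyJ]] : exists l (y : fm_entry F l j),
    (fm_mul ((A : R) j l) y : corner F j) \notin jacobson (corner F j).
  apply: contrapT => noy; case/negP: Ar; apply/asboolP => l y.
  by apply: contrapT => /negP Ay; apply: noy; exists l, y.
have [z AyzJ _] := notin_jacobson_unit j_local AyJ.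
(* Modulo [row_pred] only the row [j] matters, and there [A Z] is the identity
   up to [J(R_j)]. *)
pose Z := fm_single (fm_mul y z : fm_entry F l j).
rewrite -[1](@subKr R ((A : R) * Z)); apply: rpredB.
  exact: (rpredZ (Z : R^c) AN).
apply: rN; apply/asboolP => l' y'.
have -> : ((A : R) * Z - 1) j l' =
    fm_mul ((fm_mul ((A : R) j l) y : corner F j) * z - 1) (fm_delta F j l').
  rewrite fm_mulDl -[LHS]/(((A : R) * Z) j l' - fm_delta F j l') single_mulr.
  rewrite corner_mulE !fm_mulA; congr (_ + _).
  rewrite -{1}[fm_delta F j l']fm_mul1l; apply/eqP.
  by rewrite eq_sym -addr_eq0 -fm_mulDl addNr fm_mul0l.
by rewrite fm_mulA; exact: (jacobsonMr (_ : corner F j) AyzJ).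
Qed.
End LocalCorner.

(** * The residue isomorphism along the permutation *)

(** [socle_top_generator] over the converse ring of [R], for [e = e_i] and
    [e' = e_j]. *)
Lemma right_socle_generator i j :
  local_ring (corner F j) ->
  lmod_iso (submod_type (socle (eR F i)) : lmodType R^c) (right_top (eR F j)) ->
  exists t : fm_entry F i j, [/\ t != 0, fm_single t \in right_socle R,
    forall x : fm_entry F i j, fm_single x \in right_socle R ->
      exists b, x = fm_mul t b &
    forall k : corner F j, k \in jacobson (corner F j) -> fm_mul t k = 0].
Proof.
move=> j_local iso.
have [t [tS [te et] gen tJ t0]] := @socle_top_generator R^c (jacobson R)
  (fm_idem F i) (fm_idem F j) (idemK i) (idemK j) (jacobson_zmod_closed R)
  (fun a x => @jacobsonMr R x a) (fun a x => @jacobsonMl R a x) iso.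
have tE : fm_single ((t : R) i j) = t.
  move: te et; rewrite -[X in X = t]/((t : R) * fm_idem F j) => te.
  by rewrite -[X in X = t]/(fm_idem F i * (t : R)) -idem_corner => ->.
exists ((t : R) i j); split.
- apply: contra (idem_notin_jacobson j_local) => /eqP tij0; apply: t0.
  by rewrite -tE tij0 fm_single0.
- by rewrite tE.
- move=> x xS; have [r xE] := gen (fm_single x) xS (idem_single x).
  exists ((r : R) j j); rewrite -[LHS]fm_singleE xE.
  rewrite -[LHS]/(((t : R) * (r : R)) i j) -tE single_mull.
  by rewrite fm_deltaii fm_mul1l fm_singleE.
- move=> k /single_jacobson/tJ tk.
  have {}tk : (t : R) * fm_single k = 0 by exact: tk.
  by rewrite -[LHS]fm_singleE -single_mul tE tk.
Qed.

(** [socle_top_generator] over [R], with the roles of [i] and [j] exchanged. *)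
Lemma left_socle_generator i j :
  lmod_iso (submod_type (socle (Re F j)) : lmodType R) (left_top (Re F i)) ->
  exists t : fm_entry F i j, [/\ fm_single t \in left_socle R,
    forall x : fm_entry F i j, fm_single x \in left_socle R ->
      exists a, x = fm_mul a t &
    forall k : corner F i, k \in jacobson (corner F i) -> fm_mul k t = 0].
Proof.
move=> iso.
have [t [tS [et te] gen tJ _]] := @socle_top_generator R (jacobson R)
  (fm_idem F j) (fm_idem F i) (idemK j) (idemK i) (jacobson_zmod_closed R)
  (fun a x => @jacobsonMl R a x) (fun a x => @jacobsonMr R x a) iso.
have tE : fm_single (t i j) = t by rewrite -idem_corner et te.
exists (t i j); split; first by rewrite tE.
  move=> x xS; have [r xE] := gen (fm_single x) xS (single_idem x).
  exists (r i i); rewrite -[LHS]fm_singleE xE -tE single_mulr.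
  by rewrite fm_deltaii fm_mul1r fm_singleE.
move=> k /single_jacobson/tJ tk.
by rewrite -[LHS]fm_singleE -single_mul tE tk.
Qed.

(** An element outside the radical of a corner has an inverse modulo the
    radical, so it cannot kill [t]: the annihilators of [t] are exactly the
    radicals, and [a t = t b] relates residues injectively in both
    directions. *)
Lemma residue_iso_of_intertwiner i j (t : fm_entry F i j) :
  local_ring (corner F i) -> local_ring (corner F j) -> t != 0 ->
  (forall k : corner F i, k \in jacobson (corner F i) -> fm_mul k t = 0) ->
  (forall k : corner F j, k \in jacobson (corner F j) -> fm_mul t k = 0) ->
  (forall a : corner F i, exists b : corner F j, fm_mul a t = fm_mul t b) ->
  (forall b : corner F j, exists a : corner F i, fm_mul a t = fm_mul t b) ->
  ring_iso (residue_ring (corner F i)) (residue_ring (corner F j)).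
Proof.
move=> i_local j_local t_neq0 Jt tJ ltr rtl.
have annl (a : corner F i) : (a \in jacobson (corner F i)) = (fm_mul a t == 0).
  apply/idP/eqP => [/Jt//|at0]; apply: contrapT => /negP.
  case/(notin_jacobson_unit i_local) => b _ /Jt; rewrite corner_mulE.
  rewrite fm_mulBl fm_mulA at0 fm_mul0r sub0r fm_mul1l => /eqP.
  by rewrite oppr_eq0 (negPf t_neq0).
have annr (b : corner F j) : (b \in jacobson (corner F j)) = (fm_mul t b == 0).
  apply/idP/eqP => [/tJ//|tb0]; apply: contrapT => /negP.
  case/(notin_jacobson_unit j_local) => a /tJ + _; rewrite corner_mulE.
  rewrite fm_mulBr -fm_mulA tb0 fm_mul0l sub0r fm_mul1r => /eqP.
  by rewrite oppr_eq0 (negPf t_neq0).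
apply: (@ring_iso_of_rel
  (residue_ring (corner F i)) (residue_ring (corner F j))
  (fun x y => exists (a : corner F i) (b : corner F j),
  [/\ x = residue a, y = residue b & fm_mul a t = fm_mul t b])).
- move=> x; have [a ->] := residue_repr x; have [b ab] := ltr a.
  by exists (residue b), a, b.
- move=> y; have [b ->] := residue_repr y; have [a ab] := rtl b.
  by exists (residue a), a, b.
- move=> x x' y y' [a [b [-> -> ab]]] [a' [b' [-> -> ab']]].
  have aa'E : (residue a == residue a') = (residue b == residue b').
    by rewrite !residue_eq annl annr fm_mulBl fm_mulBr ab ab'.
  by split=> /eqP; [rewrite aa'E | rewrite -aa'E] => /eqP.
- exists 1, 1; split=> //.
  by rewrite [LHS]fm_mul1l [RHS]fm_mul1r.
- move=> x x' y y' [a [b [-> -> ab]]] [a' [b' [-> -> ab']]].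
  by exists (a - a'), (b - b'); rewrite !residueB fm_mulBl fm_mulBr ab ab'.
move=> x x' y y' [a [b [-> -> ab]]] [a' [b' [-> -> ab']]].
exists (a * a'), (b * b'); rewrite !residueM !corner_mulE.
by rewrite fm_mulA ab' -fm_mulA ab fm_mulA.
Qed.

(** The generators [t] and [t'] lie in the same bimodule because the two socles
    coincide; the first may then be used on both sides. *)
Lemma nakayama_residue_iso i j :
  local_ring (corner F i) -> local_ring (corner F j) ->
  right_socle R =i left_socle R ->
  lmod_iso (submod_type (socle (eR F i)) : lmodType R^c) (right_top (eR F j)) ->
  lmod_iso (submod_type (socle (Re F j)) : lmodType R) (left_top (Re F i)) ->
  ring_iso (residue_ring (corner F i)) (residue_ring (corner F j)).
Proof.
move=> i_local j_local socRL right_iso left_iso.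
have [t [t_neq0 tS rgen tJ]] := right_socle_generator j_local right_iso.
have [t' [_ lgen Jt']] := left_socle_generator left_iso.
have [r tE] : exists r : corner F i, t = fm_mul r t'.
  by apply: lgen; rewrite -socRL.
have Jt (k : corner F i) : k \in jacobson (corner F i) -> fm_mul k t = 0.
  by move=> kJ; rewrite tE -fm_mulA; apply/Jt'/(jacobsonMr r kJ).
have [s t'E] : exists s : corner F i, t' = fm_mul s t.
  have rJ : r \notin jacobson (corner F i).
    by apply: contraNN t_neq0 => /Jt' rt'; rewrite tE rt'.
  have [s _ /Jt' srt'] := notin_jacobson_unit i_local rJ.
  exists s; move/eqP: srt'.
  by rewrite fm_mulBl fm_mul1l subr_eq0 corner_mulE fm_mulA -tE => /eqP.
apply: (residue_iso_of_intertwiner i_local j_local t_neq0 Jt tJ) => [a|b].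
  apply: rgen; rewrite socRL -single_mul.
  have tL : fm_single t \in left_socle R by rewrite -socRL.
  exact: (@rpredZ _ _ (socle (left_regular R)) (fm_single a) _ tL).
have [a tbE] : exists a : corner F i, fm_mul t b = fm_mul a t'.
  apply: lgen; rewrite -socRL -single_mul.
  exact: (@rpredZ _ _ (socle (right_regular R)) (fm_single b : R^c) _ tS).
by exists (a * s); rewrite corner_mulE tbE t'E fm_mulA.
Qed.

End Matrices.

Theorem proposition18 (n : nat) (F : fm_data n) (p : 'S_n) (i : 'I_n)
    (Flocal : local_corners F) (Fbasic : basic F) (Fnak : nakayama_perm F p)
    (Fsoc : right_socle (fmatrix F) =i left_socle (fmatrix F)) :
  exists2 K : pzRingType, skew_field K &
    forall j : 'I_n, j \in porbit p i ->
      ring_iso (residue_ring (corner F j)) K.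
Proof.
exists (residue_ring (corner F i)) => [|_ /porbitP[k ->]]; first exact: Flocal.
elim: k => [|k IHk]; first by rewrite expg0 perm1; exact: ring_iso_refl.
apply: ring_iso_trans IHk; rewrite expgSr permM; apply: ring_iso_sym.
have [right_iso left_iso] := Fnak ((p ^+ k)%g i).
exact: nakayama_residue_iso.
Qed.
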